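(* Let $\theta>0$ and $1\le p,q<\infty$. Then the grand amalgam Lebesgue function space $l^{q),\theta}(L^p)$ is a Banach space with respect to the norm $\|\cdot\|_{p,q),\theta}$.
   Context: Let $X$ denote one of $\mathbb N$, $\mathbb N_0$ or $\mathbb Z$, and for $k\in X$ let $I_k=[k,k+1)$. For $1\le p,q<\infty$ and $\theta>0$, $l^{q),\theta}(L^p)$ is the set of all complex-valued measurable functions $g$ on $\bigcup_{k\in X}I_k$ with $g\chi_{I_k}\in L^p$ for each $k\in X$ and $$\|g\|_{p,q),\theta}:=\sup_{\varepsilon>0}\Big(\varepsilon^{\theta}\sum_{k\in X}\Big(\int_k^{k+1}|g(x)|^p\,dx\Big)^{\frac{q(1+\varepsilon)}{p}}\Big)^{\frac{1}{q(1+\varepsilon)}}<\infty$$ (functions equal a.e. identified). *)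

(* Defs.v *)
From HB Require Import structures.
From mathcomp Require Import all_boot all_order all_algebra.
From mathcomp Require Import complex.
From mathcomp Require Import all_classical all_reals all_analysis.
Set Implicit Arguments. Unset Strict Implicit. Unset Printing Implicit Defensive.
Import Order.TTheory GRing.Theory Num.Theory.
Local Open Scope classical_set_scope.
Local Open Scope ring_scope.

Inductive index_set := XN | XN0 | XZ.

Definition inX (X : index_set) (k : int) : Prop :=
  match X with
  | XN => (1 <= k)%R
  | XN0 => (0 <= k)%R
  | XZ => True
  end.

Section GrandAmalgam.
Variable R : realType.

Definition cmod (z : R[i]) : R := Normc.normc z.

Definition Ik (k : int) : set R := `[(k%:~R : R), k%:~R + 1[%classic.

Definition Dom (X : index_set) : set R := \bigcup_(k in inX X) Ik k.

Definition locint (p : R) (g : R -> R[i]) (k : int) : \bar R :=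
  (\int[lebesgue_measure]_(x in Ik k) ((cmod (g x)) `^ p)%:E)%E.

Definition ga_norm_eps (X : index_set) (p q theta : R) (g : R -> R[i]) (eps : R)
  : \bar R :=
  ((((eps `^ theta)%:E *
      \esum_(k in inX X) poweR (locint p g k) (q * (1 + eps) / p))%E)
   `^ (1 / (q * (1 + eps))))%E.

Definition ga_norm (X : index_set) (p q theta : R) (g : R -> R[i]) : \bar R :=
  ereal_sup [set ga_norm_eps X p q theta g eps | eps in `]0, +oo[%classic].

Definition cmeasurable (D : set R) (g : R -> R[i]) : Prop :=
  measurable_fun D (fun x => complex.Re (g x)) /\
  measurable_fun D (fun x => complex.Im (g x)).

(* the space l^{q),theta}(L^p) (before identification of a.e. equal functions) *)
Definition grand_amalgam (X : index_set) (p q theta : R) : set (R -> R[i]) :=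
  [set g | cmeasurable (Dom X) g /\
           (forall k, inX X k -> (locint p g k < +oo)%E) /\
           (ga_norm X p q theta g < +oo)%E].

(* (L, N) is a complex Banach space of functions on D, where functions equal
   a.e. on D are identified: L is a complex vector space of functions,
   N is a norm on the quotient (N g = 0 iff g = 0 a.e. on D), and L is
   complete for N. *)
Definition Banach_ae (D : set R) (L : set (R -> R[i]))
    (N : (R -> R[i]) -> \bar R) : Prop :=
  [/\ L (fun _ => 0),
      (forall g h, L g -> L h -> L (fun x => (g x + h x)%R)) &
      (forall (c : R[i]) g, L g -> L (fun x => (c * g x)%R))] /\
  [/\ (forall g, L g -> (0 <= N g)%E /\ (N g < +oo)%E),
      (forall g, L g ->
         (N g = 0%E <-> {ae lebesgue_measure, forall x, D x -> g x = 0})),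
      (forall (c : R[i]) g, L g -> N (fun x => (c * g x)%R) = ((cmod c)%:E * N g)%E) &
      (forall g h, L g -> L h -> (N (fun x => (g x + h x)%R) <= N g + N h)%E)] /\
      (forall u : nat -> R -> R[i], (forall n, L (u n)) ->
        (forall e : R, 0 < e -> exists N0 : nat, forall m n, (N0 <= m)%N -> (N0 <= n)%N ->
            (N (fun x => (u n x - u m x)%R) < e%:E)%E) ->
        exists2 g, L g &
          forall e : R, 0 < e -> exists N0 : nat, forall n, (N0 <= n)%N ->
            (N (fun x => (u n x - g x)%R) < e%:E)%E).

End GrandAmalgam.

(* Main.v *)
Require Import Defs.
From HB Require Import structures.
From mathcomp Require Import all_boot all_order all_algebra.
From mathcomp Require Import complex.
From mathcomp Require Import all_classical all_reals all_analysis.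
From mathcomp Require Import measurable_realfun ring.
Import Order.TTheory GRing.Theory Num.Theory.
Local Open Scope ring_scope.
Import numFieldNormedType.Exports.
Set Implicit Arguments.
Unset Strict Implicit.

(** For each [eps], the expression under the supremum is a weighted [l^r] norm
    ([r = q (1 + eps)]) of the sequence of local [L^p] norms.  Minkowski's
    inequality, on both levels, comes from the convexity of [x^r] in the form
    [(x + y)^r <= A x^r + B y^r] with [A a^r + B b^r = (a + b)^r].  At [eps = 1]
    the weight is [1], so every local norm is dominated by the grand norm;
    hence a rapidly Cauchy subsequence converges a.e. on each [Ik k], and Fatou's
    lemma bounds the local distances to the limit uniformly in [k].  A supremum
    over finite subsets of the index set then lifts the bounds on [u n - u m]
    to the limit. *)

(** * Minkowski's inequality for weighted [l^r] norms of extended-real sequences *)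

Section Minkowski.
Local Open Scope classical_set_scope.
Variable R : realType.

(** With [t = a / (a + b)], the sum [x + y] is [a + b] times the convex combination of [x / a] and
    [y / b] with weights [t] and [1 - t]. Convexity of the [r]-th power then gives
    [A = (a + b)^r t / a^r], and [B] symmetrically. The bound is linear in [x^r] and [y^r], so it
    survives summation and integration. *)
Lemma powR_split (r a b : R) : 1 <= r -> 0 < a -> 0 < b ->
  exists A B : R, [/\ 0 < A, 0 < B, A * a `^ r + B * b `^ r = (a + b) `^ r &
    forall x y, 0 <= x -> 0 <= y ->
      (x + y) `^ r <= A * x `^ r + B * y `^ r].
Proof.
move=> r1 a0 b0; have ab0 : 0 < a + b by rewrite addr_gt0.
have ar0 : a `^ r != 0 by rewrite gt_eqF// powR_gt0.
have br0 : b `^ r != 0 by rewrite gt_eqF// powR_gt0.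
exists ((a + b) `^ r * (a / (a + b)) / a `^ r).
exists ((a + b) `^ r * (b / (a + b)) / b `^ r); split.
- by rewrite !(mulr_gt0, invr_gt0, powR_gt0).
- by rewrite !(mulr_gt0, invr_gt0, powR_gt0).
- by rewrite !divfK// -mulrDr -mulrDl divff ?mulr1// gt_eqF.
move=> x y x0 y0.
have t0 : 0 <= a / (a + b) by rewrite divr_ge0// ltW.
have t1 : a / (a + b) <= 1 by rewrite ler_pdivrMr// mul1r lerDl ltW.
have onemt : unstable.onem (a / (a + b)) = b / (a + b).
  by rewrite /unstable.onem; field; rewrite gt_eqF.
have := @convex_powR R r r1 (Itv01 t0 t1) (x / a) (y / b).
rewrite !inE /= !in_itv /= !andbT => /(_ (divr_ge0 x0 (ltW a0)) (divr_ge0 y0 (ltW b0))).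
move=> H; rewrite convRE [X in X `^ _ <= _]convRE /= onemt in H.
have -> : x + y = (a + b) * (a / (a + b) * (x / a) + b / (a + b) * (y / b)).
  by field; rewrite !gt_eqF.
rewrite powRM ?(ltW ab0)//; last first.
  by rewrite addr_ge0// !mulr_ge0// ?invr_ge0 ltW.
apply: le_trans (ler_wpM2l (powR_ge0 _ _) H) _.
rewrite !powRM// ?invr_ge0 ?(ltW a0) ?(ltW b0)//.
rewrite -[a^-1]powR_inv1 ?(ltW a0)// -[b^-1]powR_inv1 ?(ltW b0)//.
rewrite -!powRrM !mulN1r !powRN.
rewrite mulrDr !mulrA.
by rewrite le_eqVlt; apply/orP; left; apply/eqP; ring.
Qed.

Local Open Scope ereal_scope.

(** Since [A] and [B] are positive, the right-hand side is infinite as soon as [x] or [y] is. *)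
Lemma poweR_split (r a b : R) : (1 <= r)%R -> (0 < a)%R -> (0 < b)%R ->
  exists A B : R, [/\ (0 < A)%R, (0 < B)%R,
    (A * a `^ r + B * b `^ r = (a + b) `^ r)%R &
    forall x y : \bar R, 0 <= x -> 0 <= y ->
      (x + y) `^ r <= A%:E * x `^ r + B%:E * y `^ r].
Proof.
move=> r1 a0 b0; have [A [B [A0 B0 AB H]]] := powR_split r1 a0 b0.
have r0 : r != 0%R by rewrite gt_eqF// (lt_le_trans _ r1).
exists A, B; split=> // -[x| |] [y| |]// x0 y0.
- by rewrite -EFinD !poweR_EFin -!EFinM -EFinD lee_fin H.
- rewrite addey// poweRyr// gt0_muley ?lte_fin// addey ?leey//.
- rewrite addye// poweRyr// gt0_muley ?lte_fin// addye ?leey//.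
- by rewrite addey// poweRyr// !gt0_muley ?lte_fin// addey ?leey.
Qed.

Lemma poweR_inv_le (r a : R) (x : \bar R) : (0 < r)%R -> (0 <= a)%R -> 0 <= x ->
  (x `^ r^-1 <= a%:E) = (x <= (a `^ r)%:E).
Proof.
move=> r0 a0 x0; have rN0 : r != 0%R by rewrite gt_eqF.
apply/idP/idP => H.
  rewrite -[x]poweRe1// -(mulVf rN0) poweRrM -poweR_EFin.
  by apply: gt0_ler_poweR; rewrite ?in_itv /= ?leey ?andbT ?poweR_ge0 ?(ltW r0) ?lee_fin.
rewrite -[a%:E]poweRe1// -(mulfV rN0) poweRrM poweR_EFin.
by apply: gt0_ler_poweR; rewrite ?in_itv /= ?leey ?andbT ?invr_ge0 ?(ltW r0) ?lee_fin
  ?powR_ge0.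
Qed.

(** Reduces a triangle inequality to a statement about balls whose radii [a] and [b] are fixed in
    advance, as the power splitting requires. *)
Lemma le_add_balls (x y z : \bar R) : 0 <= x -> 0 <= y ->
  (forall a b : R, (0 < a)%R -> (0 < b)%R -> x <= a%:E -> y <= b%:E ->
    z <= (a + b)%:E) -> z <= x + y.
Proof.
case: x y => [x| |] [y| |]//; rewrite ?leey// !lee_fin => x0 y0 H.
apply/lee_addgt0Pr => e e0.
(* The slack [e] is shared equally, so that both radii are positive even when [x] or [y] is zero. *)
have -> : x%:E + y%:E + e%:E = ((x + e / 2) + (y + e / 2))%:E.
  by rewrite -!EFinD; congr EFin; field.
have e2 : (0 < e / 2)%R by rewrite divr_gt0.
by apply: H; rewrite ?ltr_wpDl// lee_fin lerDl ltW.
Qed.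

Lemma esumZl (T : choiceType) (S : set T) (c : R) (a : T -> \bar R) :
  (0 <= c)%R -> (forall i, 0 <= a i) ->
  \esum_(i in S) (c%:E * a i) = c%:E * \esum_(i in S) a i.
Proof.
move=> c0 a0; rewrite /esum -ereal_supZl//; last first.
  by apply/set0P; eexists; exists set0 => //; exact: fsets_set0.
by rewrite image_comp; congr ereal_sup; apply: eq_imagel => A _ /=;
  rewrite ge0_mule_fsumr.
Qed.

(** The weight [c] stands inside the root, as [eps^theta] does in the grand norm. The index set is a
    parameter so that it can be shrunk to a finite subset. *)
Definition wnorm (T : choiceType) (S : set T) (c r : R) (x : T -> \bar R) :=
  (c%:E * \esum_(i in S) x i `^ r) `^ r^-1.

Lemma esum_poweR_ge0 (T : choiceType) (S : set T) (r : R) (x : T -> \bar R) :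
  0 <= \esum_(i in S) x i `^ r.
Proof. by apply: esum_ge0 => i _; exact: poweR_ge0. Qed.

Lemma le_wnorm (T : choiceType) (S : set T) (c r : R) (x y : T -> \bar R) :
  (0 <= c)%R -> (0 < r)%R -> (forall i, S i -> 0 <= x i) ->
  (forall i, S i -> x i <= y i) -> wnorm S c r x <= wnorm S c r y.
Proof.
move=> c0 r0 x0 xy; apply: gt0_ler_poweR.
- by rewrite invr_ge0 ltW.
- by rewrite in_itv/= leey andbT mule_ge0 ?esum_poweR_ge0.
- by rewrite in_itv/= leey andbT mule_ge0 ?esum_poweR_ge0.
apply: lee_pmul => //; first exact: esum_poweR_ge0.
apply: le_esum => i Si; apply: gt0_ler_poweR; rewrite ?(ltW r0)//.
- by rewrite in_itv/= leey andbT x0.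
- by rewrite in_itv/= leey andbT (le_trans (x0 _ Si))// xy.
- exact: xy.
Qed.

(** On balls of radii [a] and [b], the power splitting is summed over the indices with [A] and [B]
    constant; the resulting bound [A a^r + B b^r] is exactly [(a + b)^r]. *)
Lemma wnormD (T : choiceType) (S : set T) (c r : R) (x y : T -> \bar R) :
  (0 <= c)%R -> (1 <= r)%R -> (forall i, 0 <= x i) -> (forall i, 0 <= y i) ->
  wnorm S c r (fun i => x i + y i) <= wnorm S c r x + wnorm S c r y.
Proof.
move=> c0 r1 x0 y0; have r0 : (0 < r)%R by rewrite (lt_le_trans _ r1).
apply: le_add_balls; [exact: poweR_ge0|exact: poweR_ge0|] => a b a0 b0.
have S0 z : 0 <= c%:E * \esum_(i in S) z i `^ r.
  by rewrite mule_ge0 ?esum_poweR_ge0.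
rewrite !poweR_inv_le ?addr_ge0 ?(ltW a0) ?(ltW b0)//.
have [A [B [A0 B0 AB H]]] := poweR_split r1 a0 b0.
move=> Ha Hb; rewrite -AB.
apply: (@le_trans _ _ (A%:E * (c%:E * \esum_(i in S) x i `^ r) +
                       B%:E * (c%:E * \esum_(i in S) y i `^ r))); last first.
  by rewrite EFinD !EFinM; apply: leeD; apply: lee_pmul;
    rewrite ?lee_fin ?(ltW A0) ?(ltW B0).
rewrite !(muleCA _ c%:E) -muleDr//; last first.
  by rewrite ge0_adde_def// inE mule_ge0 ?esum_poweR_ge0 ?lee_fin ?(ltW A0) ?(ltW B0).
apply: lee_pmul; rewrite ?esum_poweR_ge0//.
rewrite -!esumZl ?(ltW A0) ?(ltW B0)//; try by move=> i; exact: poweR_ge0.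
rewrite -esumD; try by move=> i _; rewrite mule_ge0 ?poweR_ge0 ?lee_fin
  ?(ltW A0) ?(ltW B0).
by apply: le_esum => i _; exact: H.
Qed.

End Minkowski.

(** * Measurability of complex functions and local [L^p] norms on unit intervals *)

Section LocalNorm.
Local Open Scope classical_set_scope.
Variable R : realType.
Implicit Types (g h : R -> R[i]) (k : int) (D : set R).

Lemma cmod_ge0 (z : R[i]) : 0 <= cmod z.
Proof. by case: z => a b; rewrite /cmod /= sqrtr_ge0. Qed.

Lemma cmodD (z w : R[i]) : cmod (z + w) <= cmod z + cmod w.
Proof. exact: le_normcD. Qed.

Lemma cmodN (z : R[i]) : cmod (- z) = cmod z.
Proof. by case: z => a b; rewrite /cmod /= !sqrrN. Qed.

Lemma cmodB (z w : R[i]) : cmod (z - w) = cmod (w - z).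
Proof. by rewrite -cmodN opprB. Qed.

Lemma Re_le_cmod (z : R[i]) : `|complex.Re z| <= cmod z.
Proof.
by case: z => a b; rewrite /cmod /= -sqrtr_sqr ler_wsqrtr// lerDl sqr_ge0.
Qed.

Lemma Im_le_cmod (z : R[i]) : `|complex.Im z| <= cmod z.
Proof.
by case: z => a b; rewrite /cmod /= -sqrtr_sqr ler_wsqrtr// lerDr sqr_ge0.
Qed.

Lemma cmod_real (x : R) : cmod (x%:C)%C = `|x|.
Proof. by rewrite /cmod /= expr0n/= addr0 sqrtr_sqr. Qed.

Lemma ae_mono (P Q : R -> Prop) : (forall x, P x -> Q x) ->
  {ae lebesgue_measure, forall x, P x} -> {ae lebesgue_measure, forall x, Q x}.
Proof. by move=> PQ; apply: negligibleS; apply: subsetC. Qed.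

Lemma measurable_Ik k : measurable (@Ik R k).
Proof. exact: measurable_itv. Qed.

Lemma measurable_Dom X : measurable (@Dom R X).
Proof.
rewrite /Dom bigcup_mkcond; apply: countable_bigcupT_measurable => // k.
by case: ifP => // _; exact: measurable_Ik.
Qed.

Lemma Ik_sub_Dom X k : inX X k -> @Ik R k `<=` Dom X.
Proof. by move=> Xk x kx; exists k. Qed.

Lemma cmeasurableS D E g : measurable E -> D `<=` E ->
  cmeasurable E g -> cmeasurable D g.
Proof. by move=> mE DE [? ?]; split; apply: measurable_funS DE _. Qed.

Lemma cmeasurable_Ik X k g : inX X k -> cmeasurable (Dom X) g ->
  cmeasurable (Ik k) g.
Proof.
by move=> Xk; apply: cmeasurableS (Ik_sub_Dom Xk); exact: measurable_Dom.
Qed.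

Lemma cmeasurableD D g h : cmeasurable D g -> cmeasurable D h ->
  cmeasurable D (fun x => g x + h x).
Proof.
move=> [gr gi] [hr hi]; split.
- rewrite (_ : (fun _ => _) = (fun x => complex.Re (g x) + complex.Re (h x))).
    exact: measurable_funD.
  by apply/funext => x; rewrite raddfD.
- rewrite (_ : (fun _ => _) = (fun x => complex.Im (g x) + complex.Im (h x))).
    exact: measurable_funD.
  by apply/funext => x; rewrite raddfD.
Qed.

Lemma cmeasurableZ D (c : R[i]) g : cmeasurable D g ->
  cmeasurable D (fun x => c * g x).
Proof.
case: c => a b [gr gi]; split.
- rewrite (_ : (fun _ => _) =
    (fun x => a * complex.Re (g x) - b * complex.Im (g x))).
    by apply: measurable_funB; apply: measurable_funM.
  by apply/funext => x; case: (g x).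
- rewrite (_ : (fun _ => _) =
    (fun x => a * complex.Im (g x) + b * complex.Re (g x))).
    by apply: measurable_funD; apply: measurable_funM.
  by apply/funext => x; case: (g x).
Qed.

Lemma cmeasurableB D g h : cmeasurable D g -> cmeasurable D h ->
  cmeasurable D (fun x => g x - h x).
Proof.
move=> mg mh; rewrite (_ : (fun _ => _) = (fun x => g x + (-1) * h x)).
  by apply: cmeasurableD => //; exact: cmeasurableZ.
by apply/funext => x; rewrite mulN1r.
Qed.

Lemma measurable_cmod D g : cmeasurable D g ->
  measurable_fun D (fun x => cmod (g x)).
Proof.
move=> [gr gi].
rewrite (_ : (fun _ => _) =
    Num.sqrt \o (fun x => complex.Re (g x) ^+ 2 + complex.Im (g x) ^+ 2)).
  apply: measurableT_comp.
    by apply: continuous_measurable_fun; exact: sqrt_continuous.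
  by apply: measurable_funD; apply: measurable_funX.
by apply/funext => x /=; case: (g x).
Qed.

Lemma measurable_cmod_powR D p g : cmeasurable D g ->
  measurable_fun D (fun x => (cmod (g x) `^ p)%:E).
Proof.
move=> mg; apply/measurable_EFinP.
by apply: (measurableT_comp (measurable_powR p)); exact: measurable_cmod.
Qed.

Local Open Scope ereal_scope.

Definition lnorm (p : R) g k : \bar R := locint p g k `^ p^-1.

Lemma locint_ge0 p g k : 0 <= locint p g k.
Proof. by apply: integral_ge0 => x _; rewrite lee_fin powR_ge0. Qed.

Lemma lnorm_ge0 p g k : 0 <= lnorm p g k.
Proof. exact: poweR_ge0. Qed.

Lemma lnorm_le p (a : R) g k : (0 < p)%R -> (0 <= a)%R ->
  (lnorm p g k <= a%:E) = (locint p g k <= (a `^ p)%:E).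
Proof. by move=> p0 a0; rewrite poweR_inv_le// locint_ge0. Qed.

Lemma lnorm_lty p g k : (0 < p)%R -> (lnorm p g k < +oo) = (locint p g k < +oo).
Proof.
move=> p0; apply/idP/idP => [|/poweR_lty]; last exact.
by apply: lty_poweRy; rewrite invr_eq0 gt_eqF.
Qed.

(** The argument for weighted sums, with the integral over [Ik k] in place of the sum. *)
Lemma lnormD p g h k : (1 <= p)%R -> cmeasurable (Ik k) g ->
  cmeasurable (Ik k) h ->
  lnorm p (fun x => g x + h x)%R k <= lnorm p g k + lnorm p h k.
Proof.
move=> p1 mg mh; have p0 : (0 < p)%R by rewrite (lt_le_trans _ p1).
apply: le_add_balls; [exact: lnorm_ge0|exact: lnorm_ge0|] => a b a0 b0.
rewrite !lnorm_le ?addr_ge0 ?(ltW a0) ?(ltW b0)// => Ha Hb.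
have [A [B [A0 B0 <- H]]] := powR_split p1 a0 b0.
have mp f : cmeasurable (Ik k) f ->
    measurable_fun (Ik k) (fun x => (cmod (f x) `^ p)%:E).
  exact: measurable_cmod_powR.
apply: (@le_trans _ _ (A%:E * locint p g k + B%:E * locint p h k)); last first.
  by rewrite EFinD !EFinM; apply: leeD; apply: lee_pmul;
    rewrite ?lee_fin ?(ltW A0) ?(ltW B0) ?locint_ge0.
rewrite /locint.
have ge0 (f : R -> R[i]) x : 0 <= (cmod (f x) `^ p)%:E.
  by rewrite lee_fin powR_ge0.
have mI := measurable_Ik k.
rewrite -!ge0_integralZl// ?lee_fin ?(ltW A0) ?(ltW B0)//; try exact: mp.
rewrite -ge0_integralD//; last first.
- by apply: measurable_funeM; exact: mp.
- by move=> x _; rewrite mule_ge0// lee_fin ltW.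
- by apply: measurable_funeM; exact: mp.
- by move=> x _; rewrite mule_ge0// lee_fin ltW.
apply: ge0_le_integral => //.
- by move=> x _; exact: (ge0 (fun x => g x + h x)%R).
- by apply: mp; exact: cmeasurableD.
- by apply: emeasurable_funD; apply: measurable_funeM; exact: mp.
move=> x _; rewrite -!EFinM -EFinD lee_fin.
apply: le_trans (H _ _ (cmod_ge0 _) (cmod_ge0 _)).
by apply: ge0_ler_powR; rewrite ?nnegrE ?(ltW p0) ?addr_ge0 ?cmod_ge0 ?cmodD.
Qed.

Lemma lnormZ p (c : R[i]) g k : (0 < p)%R -> cmeasurable (Ik k) g ->
  lnorm p (fun x => c * g x)%R k = (cmod c)%:E * lnorm p g k.
Proof.
move=> p0 mg; rewrite /lnorm.
have -> : locint p (fun x => c * g x)%R k = (cmod c `^ p)%:E * locint p g k.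
  rewrite /locint -ge0_integralZl//.
  - apply: eq_integral => x _.
    by rewrite -EFinM -powRM ?cmod_ge0//; congr (_ `^ _)%:E; exact: Normc.normcM.
  - exact: measurable_Ik.
  - exact: measurable_cmod_powR.
  - by move=> x _; rewrite lee_fin powR_ge0.
  - by rewrite lee_fin powR_ge0.
rewrite poweRM ?locint_ge0 ?lee_fin ?powR_ge0// poweR_EFin -powRrM mulfV ?gt_eqF//.
by rewrite powRr1 ?cmod_ge0.
Qed.

Lemma eq_lnorm p g h k : (forall x, cmod (g x) = cmod (h x)) ->
  lnorm p g k = lnorm p h k.
Proof.
by move=> gh; rewrite /lnorm /locint; congr (_ `^ _); apply: eq_integral => x _;
  rewrite gh.
Qed.

Lemma lnorm_eq0 p g k : (0 < p)%R -> cmeasurable (Ik k) g ->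
  lnorm p g k = 0 <-> {ae lebesgue_measure, forall x, Ik k x -> g x = 0%R}.
Proof.
move=> p0 mg; have pN0 : p != 0%R by rewrite gt_eqF.
have mp := @measurable_cmod_powR _ p _ mg.
have E : lnorm p g k = 0 <->
    \int[lebesgue_measure]_(x in Ik k) `|(cmod (g x) `^ p)%:E| = 0.
  rewrite (_ : \int[_]_(x in _) _ = locint p g k); last first.
    by apply: eq_integral => x _; rewrite gee0_abs// lee_fin powR_ge0.
  split=> [|l0]; first by apply: poweR_eq0_eq0; exact: locint_ge0.
  by rewrite /lnorm l0 poweR0r// invr_eq0.
rewrite E ae_eq_integral_abs//; last exact: measurable_Ik.
split; apply: ae_mono => x /= H kx; move: (H kx).
  by move=> [] /powR_eq0_eq0 /Normc.eq0_normc.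
by move=> ->; rewrite /cmod Normc.normc0 powR0.
Qed.

End LocalNorm.

(** * Fatou's lemma and almost everywhere convergence on a unit interval *)

Section LocalConvergence.
Local Open Scope classical_set_scope.
Variable R : realType.
Implicit Types (g h : R -> R[i]) (k : int) (D : set R).

(** At a positive limit the power is differentiable, hence continuous. At the limit zero it need not
    be differentiable, and the threshold [e^(1/p)] is used directly. *)
Lemma cvg_powR (x_ : R^nat) (l p : R) : 0 < p -> (forall n, 0 <= x_ n) ->
  x_ n @[n --> \oo] --> l -> x_ n `^ p @[n --> \oo] --> l `^ p.
Proof.
move=> p0 x0 xl.
have l0 : 0 <= l.
  rewrite -(cvg_lim (@Rhausdorff R) xl); apply: limr_ge; last exact: nearW.
  by apply: cvgP xl.
have [l_gt0|l_lt0|l_eq0] := ltgtP 0 l; last first.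
- move: xl; rewrite -l_eq0 powR0 ?gt_eqF// => xl.
  apply/cvgrPdist_le => e e0.
  have ep0 : 0 < e `^ p^-1 by rewrite powR_gt0.
  move/cvgrPdist_le : xl => /(_ _ ep0); apply: filterS => n.
  rewrite !sub0r !normrN !ger0_norm ?powR_ge0// => xe.
  rewrite (_ : e = (e `^ p^-1) `^ p); last first.
    by rewrite -powRrM mulVf ?gt_eqF// powRr1// ltW.
  by apply: ge0_ler_powR; rewrite ?nnegrE ?powR_ge0 ?(ltW p0).
- by rewrite ltNge l0 in l_lt0.
apply: (@continuous_cvg _ _ _ _ _ _ (fun x : R => x `^ p)) => //.
apply: differentiable_continuous; apply/derivable1_diffP.
by apply: derivable_powR; rewrite in_itv/= l_gt0.
Qed.

(** Convergence is taken componentwise, to match [cmeasurable]. *)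
Definition ccvg (z : nat -> R[i]) (l : R[i]) :=
  (complex.Re (z n) @[n --> \oo] --> complex.Re l) /\
  (complex.Im (z n) @[n --> \oo] --> complex.Im l).

Lemma ccvgB z l (w : R[i]) : ccvg z l -> ccvg (fun n => z n - w) (l - w).
Proof.
move=> [zr zi]; split; rewrite raddfB /=.
- rewrite (_ : (fun _ => _) = (fun n => complex.Re (z n) - complex.Re w)).
    by apply: cvgB => //; exact: cvg_cst.
  by apply/funext => n; rewrite raddfB.
- rewrite (_ : (fun _ => _) = (fun n => complex.Im (z n) - complex.Im w)).
    by apply: cvgB => //; exact: cvg_cst.
  by apply/funext => n; rewrite raddfB.
Qed.

Lemma cvg_cmod z l : ccvg z l -> cmod (z n) @[n --> \oo] --> cmod l.
Proof.
move=> [zr zi].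
have E (w : R[i]) : cmod w =
    Num.sqrt (complex.Re w * complex.Re w + complex.Im w * complex.Im w).
  by case: w.
rewrite E (_ : (fun _ => _) = (fun n => Num.sqrt
    (complex.Re (z n) * complex.Re (z n) + complex.Im (z n) * complex.Im (z n)))).
  apply: (@continuous_cvg _ _ _ _ _ _ (@Num.sqrt R)).
    exact: sqrt_continuous.
  by apply: cvgD; apply: cvgM.
by apply/funext => n; rewrite E.
Qed.

Local Open Scope ereal_scope.

Lemma fatou_le d (T : measurableType d) (mu : {measure set T -> \bar R})
    (D : set T) (f : (T -> \bar R)^nat) (c : \bar R) : measurable D ->
  (forall n, measurable_fun D (f n)) -> (forall n x, D x -> 0 <= f n x) ->
  (forall n, \int[mu]_(x in D) f n x <= c) ->
  \int[mu]_(x in D) limn_einf (f ^~ x) <= c.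
Proof.
move=> mD mf f0 fc; apply: le_trans (fatou _ _ _ _) _ => //.
rewrite limn_einf_lim; apply: lime_le; first exact: is_cvg_einfs.
apply: nearW => n; apply: le_trans (fc n).
by apply: ereal_inf_lbound; exists n => /=.
Qed.

Lemma limn_einf_ge0 (u : (\bar R)^nat) : (forall n, 0 <= u n) ->
  0 <= limn_einf u.
Proof.
move=> u0; rewrite limn_einf_lim; apply: lime_ge; first exact: is_cvg_einfs.
by apply: nearW => n; apply: le_ereal_inf_tmp => _ [m /= _ <-].
Qed.

Lemma measurable_fun_limn_einf d (T : measurableType d) (D : set T)
    (f : (T -> \bar R)^nat) : (forall n, measurable_fun D (f n)) ->
  measurable_fun D (fun x => limn_einf (f ^~ x)).
Proof.
move=> mf; rewrite (_ : (fun _ => _) =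
    (fun x => - limn_esup ((fun n x => - f n x) ^~ x))).
  apply: measurableT_comp => //; apply: measurable_fun_limn_esup => n.
  exact: measurableT_comp.
by apply/funext => x; rewrite -limn_einfN; congr limn_einf;
  apply/funext => n /=; rewrite oppeK.
Qed.

(** Almost everywhere convergence identifies the lower limit of [|w n|^p] with [|g|^p], and Fatou's
    lemma bounds the integral of that lower limit by [a^p]. *)
Lemma lnorm_fatou p (a : R) (w : nat -> R -> R[i]) g k :
  (0 < p)%R -> (0 <= a)%R -> (forall n, cmeasurable (Ik k) (w n)) ->
  cmeasurable (Ik k) g ->
  {ae lebesgue_measure, forall x, Ik k x -> ccvg (w ^~ x) (g x)} ->
  (forall n, lnorm p (w n) k <= a%:E) -> lnorm p g k <= a%:E.
Proof.
move=> p0 a0 mw mg wg wa; rewrite lnorm_le//.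
have mI : measurable (@Ik R k) := measurable_Ik k.
have ge0 (f : R -> R[i]) x : 0 <= (cmod (f x) `^ p)%:E.
  by rewrite lee_fin powR_ge0.
pose F n x := (cmod (w n x) `^ p)%:E.
have mF n : measurable_fun (Ik k) (F n) by exact: measurable_cmod_powR.
apply: (@le_trans _ _ (\int[lebesgue_measure]_(x in Ik k) limn_einf (F ^~ x))).
  apply: ae_ge0_le_integral => //.
  - exact: measurable_cmod_powR.
  - by move=> x _; apply: limn_einf_ge0 => n; exact: (ge0 (w n)).
  - exact: measurable_fun_limn_einf.
  apply: ae_mono wg => x wgx kx.
  suff /cvg_limn_einf_sup[-> _] : F n x @[n --> \oo] --> (cmod (g x) `^ p)%:E.
    by [].
  apply: cvg_EFin; first exact: nearW.
  apply: cvg_powR => //; first by move=> n; exact: cmod_ge0.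
  by apply: cvg_cmod; exact: wgx.
apply: fatou_le => //.
- by move=> n x _; exact: (ge0 (w n)).
- by move=> n; rewrite -lnorm_le.
Qed.

(** The telescoping series of [u] converges absolutely by comparison with [b]. *)
Lemma cvg_telescope_bound (u : R^nat) (b : R^nat) :
  (forall n, `|u n.+1 - u n| <= b n)%R -> cvgn (series b) -> cvgn u.
Proof.
move=> ub cb.
have cu : cvgn (series (telescope u)).
  apply: normed_cvg; apply: series_le_cvg cb => n /=.
  - exact: normr_ge0.
  - exact: le_trans (normr_ge0 _) (ub n).
  - exact: ub.
rewrite telescopeK in cu.
rewrite (_ : u = (fun n => (u n - u 0%N) + u 0%N)%R); last first.
  by apply/funext => n; rewrite subrK.
by apply: is_cvgD => //; exact: is_cvg_cst.
Qed.

Lemma lnorm0 p k : (0 < p)%R -> lnorm p (fun=> 0%R : R[i]) k = 0.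
Proof.
move=> p0; apply/lnorm_eq0 => //; exact: aeW.
Qed.

(** The Riesz-Fischer argument: the partial sums [G n] of [|v (n+1) - v n|] have [L^p] norm at most
    [2], so by Fatou's lemma they stay bounded at almost every point, and there the increments of
    [v] are absolutely summable. *)
Lemma ae_cvg_fast p (v : nat -> R -> R[i]) k : (1 <= p)%R ->
  (forall n, cmeasurable (Ik k) (v n)) ->
  (forall n, lnorm p (fun x => v n.+1 x - v n x)%R k <= (2^-1 ^+ n)%:E) ->
  {ae lebesgue_measure, forall x, Ik k x ->
    cvgn (fun n => complex.Re (v n x)) /\ cvgn (fun n => complex.Im (v n x))}.
Proof.
move=> p1 mv vd; have p0 : (0 < p)%R by rewrite (lt_le_trans _ p1).
pose b x n := cmod (v n.+1 x - v n x)%R.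
pose G n x := series (b x) n.
have b0 x n : (0 <= b x n)%R by exact: cmod_ge0.
have G0 n x : (0 <= G n x)%R by rewrite /G /series /= sumr_ge0.
have GS n x : G n.+1 x = (G n x + b x n)%R by rewrite /G seriesSr.
have mb n : measurable_fun (Ik k) (b ^~ n).
  by apply: measurable_cmod; exact: cmeasurableB.
have mG n : measurable_fun (Ik k) (G n).
  elim: n => [|n IH].
    rewrite (_ : G 0%N = cst 0%R); first exact: measurable_cst.
    by apply/funext => x; rewrite /G /series /= big_geq.
  rewrite (_ : G n.+1 = (fun x => G n x + b x n)%R); last exact/funext.
  exact: measurable_funD.
(* [lnorm] takes complex functions, so the real sums [G n] are embedded in [R[i]]. *)
have cm (f : R -> R) : measurable_fun (Ik k) f ->
    cmeasurable (Ik k) (fun x => (f x)%:C%C).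
  by move=> mf; split => //; exact: measurable_cst.
have lG n : lnorm p (fun x => (G n x)%:C%C) k <= (series (geometric 1 2^-1) n)%:E.
  elim: n => [|n IH].
    rewrite (_ : (fun x => _) = (fun=> 0%R)) ?lnorm0 ?lee_fin//.
      by rewrite /series /= big_geq.
    by apply/funext => x; rewrite /G /series /= big_geq.
  rewrite (_ : (fun x => _) = (fun x => (G n x)%:C%C + (b x n)%:C%C)%R); last first.
    by apply/funext => x; rewrite GS raddfD.
  apply: le_trans (lnormD p1 (cm _ (mG n)) (cm _ (mb n))) _.
  rewrite seriesSr EFinD; apply: leeD => //.
  rewrite (@eq_lnorm _ p _ (fun x => v n.+1 x - v n x)%R); last first.
    by move=> x; rewrite cmod_real ger0_norm.
  by rewrite /geometric /= mul1r.
(* [2] is the sum of the full geometric series of ratio [1/2]. *)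
have l2 n : lnorm p (fun x => (G n x)%:C%C) k <= 2%:E.
  apply: le_trans (lG n) _; rewrite lee_fin.
  apply: le_trans (geometric_le_lim _ _ _ _) _ => //.
  - by rewrite ger0_norm// invf_lt1// ltr1n.
  - by rewrite le_eqVlt; apply/orP; left; apply/eqP; field.
pose F n x := (cmod (G n x)%:C%C `^ p)%:E.
have mI : measurable (@Ik R k) := measurable_Ik k.
have mF n : measurable_fun (Ik k) (F n) by apply: measurable_cmod_powR; exact: cm.
have F0 n x : 0 <= F n x by rewrite lee_fin powR_ge0.
have iF : \int[lebesgue_measure]_(x in Ik k) limn_einf (F ^~ x) <= (2 `^ p)%:E.
  by apply: fatou_le => // n; have := l2 n; rewrite lnorm_le.
have : lebesgue_measure.-integrable (Ik k) (fun x => limn_einf (F ^~ x)).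
  apply/integrableP; split; first exact: measurable_fun_limn_einf.
  apply: le_lt_trans (ltry (2 `^ p)); apply: le_trans iF.
  rewrite le_eqVlt; apply/orP; left; apply/eqP; apply: eq_integral => x _.
  by rewrite gee0_abs// limn_einf_ge0.
move=> /integrable_ae H; apply: ae_mono (H mI) => x {}H kx.
have {H} Fx := H kx.
have ndG : nondecreasing_seq (G ^~ x).
  by apply/nondecreasing_seqP => n; rewrite GS lerDl.
have ndF : nondecreasing_seq (F ^~ x).
  move=> m n mn; rewrite lee_fin !cmod_real !ger0_norm//.
  by apply: ge0_ler_powR; rewrite ?nnegrE ?(ltW p0)//; exact: ndG.
(* An integrable function is finite almost everywhere, so [fine] loses nothing at this [x]; by
   monotonicity the lower limit is the supremum of the [F n x]. *)
have FM n : F n x <= (fine (limn_einf (F ^~ x)))%:E.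
  rewrite fineK// is_cvg_limn_einfE; last exact: ereal_nondecreasing_is_cvgn.
  have /cvg_lim -> // := ereal_nondecreasing_cvgn ndF.
  by apply: ereal_sup_ubound; exists n.
move: (fine _) FM => M FM.
have GM n : (G n x <= M `^ p^-1)%R.
  have := FM n; rewrite lee_fin cmod_real ger0_norm// => GpM.
  have M0 : (0 <= M)%R by rewrite (le_trans _ GpM)// powR_ge0.
  rewrite -[leLHS]powRr1// -(mulfV (lt0r_neq0 p0)) powRrM.
  by apply: ge0_ler_powR; rewrite ?nnegrE ?invr_ge0 ?powR_ge0 ?(ltW p0).
have cb : cvgn (series (b x)).
  apply: nondecreasing_is_cvgn => //; exists (M `^ p^-1)%R.
  by move=> _ [n _ <-]; exact: GM.
split; apply: cvg_telescope_bound cb => n; rewrite -raddfB.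
- exact: Re_le_cmod.
- exact: Im_le_cmod.
Qed.

End LocalConvergence.

(** * Scaling of weighted norms and passage to finite index sets *)

Section WeightedNorm.
Local Open Scope classical_set_scope.
Local Open Scope ereal_scope.
Variables (R : realType) (T : choiceType).
Implicit Types (S : set T) (c r : R) (x y : T -> \bar R).

Lemma eq_wnorm S c r x y : (forall i, S i -> x i = y i) ->
  wnorm S c r x = wnorm S c r y.
Proof.
by move=> xy; rewrite /wnorm; congr ((_ * _) `^ _); apply: eq_esum => i /xy ->.
Qed.

Lemma wnormZ S c r (d : R) x : (0 <= c)%R -> (0 < r)%R -> (0 <= d)%R ->
  (forall i, 0 <= x i) ->
  wnorm S c r (fun i => d%:E * x i) = d%:E * wnorm S c r x.
Proof.
move=> c0 r0 d0 x0; rewrite /wnorm.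
rewrite (eq_esum (b := fun i => (d `^ r)%:E * x i `^ r)); last first.
  by move=> i _; rewrite poweRM ?lee_fin.
rewrite esumZl ?powR_ge0//; last by move=> i; exact: poweR_ge0.
have S0 : 0 <= c%:E * \esum_(i in S) x i `^ r.
  by rewrite mule_ge0 ?esum_poweR_ge0.
rewrite muleCA [LHS]poweRM ?lee_fin ?powR_ge0//.
by rewrite poweR_EFin -powRrM mulfV ?gt_eqF// powRr1.
Qed.

Lemma wnorm0 S c r x : (0 < r)%R -> (forall i, S i -> x i = 0) ->
  wnorm S c r x = 0.
Proof.
move=> r0 x0; rewrite /wnorm esum1 ?mule0 ?poweR0r ?invr_eq0 ?gt_eqF//.
by move=> i /x0 ->; rewrite poweR0r// gt_eqF.
Qed.

Lemma le_wnorm_subset S S' c r x : (0 <= c)%R -> (0 < r)%R -> S `<=` S' ->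
  wnorm S c r x <= wnorm S' c r x.
Proof.
move=> c0 r0 SS'; apply: gt0_ler_poweR.
- by rewrite invr_ge0 ltW.
- by rewrite in_itv/= leey andbT mule_ge0 ?esum_poweR_ge0.
- by rewrite in_itv/= leey andbT mule_ge0 ?esum_poweR_ge0.
apply: lee_pmul => //; first exact: esum_poweR_ge0.
apply/ereal_supP => _ [F [finF FS] <-]; apply: esum_ge; exists F => //.
by split=> //; exact: subset_trans SS'.
Qed.

(** The sum is by definition a supremum over finite subsets; positivity of [c] allows the weight to
    be moved across the inequality. *)
Lemma wnorm_fsets S c r x (a : R) : (0 < c)%R -> (0 < r)%R -> (0 <= a)%R ->
  (forall F, fsets S F -> wnorm F c r x <= a%:E) -> wnorm S c r x <= a%:E.
Proof.
move=> c0 r0 a0 H; have S0 F : 0 <= c%:E * \esum_(i in F) x i `^ r.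
  by rewrite mule_ge0 ?esum_poweR_ge0// lee_fin ltW.
rewrite poweR_inv_le// -lee_pdivlMl//; apply/ereal_supP => _ [F SF <-].
rewrite lee_pdivlMl//; have := H F SF; rewrite poweR_inv_le// esum_fset//.
  by case: SF.
by move=> i _; exact: poweR_ge0.
Qed.

(** Makes a uniform error in the local norms harmless on a finite index set. *)
Lemma wnorm_fset_cst_lty S c r (d : R) : (0 <= c)%R -> finite_set S ->
  wnorm S c r (fun=> d%:E) < +oo.
Proof.
move=> c0 finS; apply: poweR_lty; rewrite esum_fset//; last first.
  by move=> i _; exact: poweR_ge0.
rewrite fsbig_finite//= sumEFin -EFinM ltry//.
Qed.

(** A singleton is one of the finite subsets over which the sum is a supremum. *)
Lemma le_wnorm_ge S r x i : (0 < r)%R -> S i -> 0 <= x i ->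
  x i <= wnorm S 1 r x.
Proof.
move=> r0 Si x0; rewrite /wnorm mul1e.
rewrite -[leLHS]poweRe1// -(mulfV (lt0r_neq0 r0)) poweRrM.
apply: gt0_ler_poweR.
- by rewrite invr_ge0 ltW.
- by rewrite in_itv/= leey andbT poweR_ge0.
- by rewrite in_itv/= leey andbT esum_poweR_ge0.
apply: esum_ge; exists [set i]; last by rewrite fsbig_set1.
by split; [exact: finite_set1|move=> _ ->].
Qed.

End WeightedNorm.

(** * The grand norm as a supremum of weighted norms of local norms *)

Section GrandNorm.
Local Open Scope classical_set_scope.
Variable R : realType.
Variables (X : index_set) (p q theta : R).
Hypotheses (p1 : 1 <= p) (q1 : 1 <= q).
Implicit Types (g h : R -> R[i]) (k : int).

Let p0 : 0 < p. Proof. by rewrite (lt_le_trans _ p1). Qed.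

Let r1 eps : 0 < eps -> 1 <= q * (1 + eps).
Proof.
by move=> e0; rewrite -[leLHS]mulr1 ler_pM// lerDl ltW.
Qed.

Let r0 eps : 0 < eps -> 0 < q * (1 + eps).
Proof. by move=> /r1; exact: lt_le_trans. Qed.

Local Open Scope ereal_scope.
Local Notation N := (ga_norm X p q theta).

(** The exponent [q (1 + eps) / p] on the local integral is the exponent [q (1 + eps)] on its [p]-th
    root. *)
Lemma ga_norm_epsE g eps : ga_norm_eps X p q theta g eps =
  wnorm (inX X) (eps `^ theta) (q * (1 + eps)) (lnorm p g).
Proof.
rewrite /ga_norm_eps /wnorm div1r; congr ((_ * _) `^ _).
by apply: eq_esum => k _; rewrite /lnorm -poweRrM mulrC.
Qed.

Lemma ga_normP g (a : \bar R) :
  N g <= a <-> forall eps : R, (0 < eps)%R ->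
    wnorm (inX X) (eps `^ theta) (q * (1 + eps)) (lnorm p g) <= a.
Proof.
split=> [Ng eps e0|H].
  apply: le_trans Ng; rewrite -ga_norm_epsE; apply: ereal_sup_ubound.
  by exists eps => //=; rewrite in_itv/= e0.
apply/ereal_supP => _ [eps /= + <-]; rewrite in_itv/= andbT => e0.
by rewrite ga_norm_epsE; exact: H.
Qed.

Lemma wnorm_le_ga_norm g eps : (0 < eps)%R ->
  wnorm (inX X) (eps `^ theta) (q * (1 + eps)) (lnorm p g) <= N g.
Proof. by move: eps; apply/ga_normP. Qed.

Lemma ga_norm_ge0 g : 0 <= N g.
Proof. by apply: le_trans (wnorm_le_ga_norm g ltr01); exact: poweR_ge0. Qed.

(** Grand bounds thus become local bounds uniform in [k], with constant [1]. *)
Lemma lnorm_le_ga_norm g k : inX X k -> lnorm p g k <= N g.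
Proof.
move=> Xk; apply: le_trans (wnorm_le_ga_norm g ltr01).
by rewrite powR1; apply: le_wnorm_ge => //; [exact: r0|exact: lnorm_ge0].
Qed.

Lemma eq_ga_norm g h : (forall x, cmod (g x) = cmod (h x)) -> N g = N h.
Proof.
move=> gh; have E k : lnorm p g k = lnorm p h k by exact: eq_lnorm.
have le f f' : (forall k, lnorm p f k = lnorm p f' k) -> N f <= N f'.
  move=> ff'; apply/ga_normP => eps e0.
  rewrite (@eq_wnorm _ _ _ _ _ _ (lnorm p f')) ?wnorm_le_ga_norm//.
by apply: le_anti; apply/andP; split; apply: le => k; rewrite E.
Qed.

Lemma ga_normD g h : cmeasurable (Dom X) g -> cmeasurable (Dom X) h ->
  N (fun x => g x + h x)%R <= N g + N h.
Proof.
move=> mg mh; apply/ga_normP => eps e0.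
apply: (@le_trans _ _ (wnorm (inX X) (eps `^ theta) (q * (1 + eps))
    (fun k => lnorm p g k + lnorm p h k))).
  apply: le_wnorm; [exact: powR_ge0|exact: r0| |].
    by move=> k _; exact: lnorm_ge0.
  by move=> k Xk; apply: lnormD => //; exact: (cmeasurable_Ik Xk).
apply: le_trans (wnormD _ _ _ _ _) _; [exact: powR_ge0|exact: r1| | |].
- by move=> k; exact: lnorm_ge0.
- by move=> k; exact: lnorm_ge0.
- by apply: leeD; exact: wnorm_le_ga_norm.
Qed.

Lemma ga_normZ (c : R[i]) g : cmeasurable (Dom X) g ->
  N (fun x => c * g x)%R = (cmod c)%:E * N g.
Proof.
move=> mg; rewrite /ga_norm -ereal_supZl ?cmod_ge0//; last first.
  by apply/set0P; eexists; exists 1%R => //=; rewrite in_itv/= ltr01.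
rewrite image_comp; congr ereal_sup; apply: eq_imagel => eps /=.
rewrite in_itv/= andbT => e0; rewrite !ga_norm_epsE -wnormZ ?cmod_ge0//.
- apply: eq_wnorm => k Xk; apply: lnormZ => //; exact: (cmeasurable_Ik Xk).
- exact: powR_ge0.
- exact: r0.
- by move=> k; exact: lnorm_ge0.
Qed.

Lemma ga_normB g h : N (fun x => g x - h x)%R = N (fun x => h x - g x)%R.
Proof. by apply: eq_ga_norm => x; exact: cmodB. Qed.

Lemma ae_Dom (P : R -> Prop) :
  (forall k, inX X k -> {ae lebesgue_measure, forall x, Ik k x -> P x}) <->
  {ae lebesgue_measure, forall x, Dom X x -> P x}.
Proof.
split=> [H|H k Xk]; last first.
  by apply: ae_mono H => x Px kx; apply: Px; exists k.
(* The integers are enumerated by their codes, so that countably many null sets are united; codes of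
   no integer impose no condition. *)
pose Q n x := if unpickle n is Some k then inX X k -> Ik k x -> P x else True.
have : {ae lebesgue_measure, forall x, forall n, Q n x}.
  apply: ae_foralln => n; rewrite /Q; case: (unpickle n) => [k|]; last exact: aeW.
  have [Xk|nXk] := pselect (inX X k); last by apply: aeW.
  by apply: ae_mono (H k Xk) => x.
apply: ae_mono => x Qx [k Xk kx].
by have := Qx (pickle k); rewrite /Q pickleK; exact.
Qed.

Lemma ga_norm_eq0 g : cmeasurable (Dom X) g ->
  N g = 0 <-> {ae lebesgue_measure, forall x, Dom X x -> g x = 0%R}.
Proof.
move=> mg; rewrite -ae_Dom.
have mk k : inX X k -> cmeasurable (Ik k) g by move=> Xk; exact: (cmeasurable_Ik Xk).
split=> [N0 k Xk|H].
  apply/(lnorm_eq0 p0 (mk _ Xk)); apply/eqP.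
  by rewrite eq_le lnorm_ge0 -N0 lnorm_le_ga_norm.
apply/eqP; rewrite eq_le ga_norm_ge0 andbT; apply/ga_normP => eps e0.
rewrite wnorm0//; first exact: r0.
by move=> k Xk; apply/lnorm_eq0; [exact: p0|exact: mk|exact: H].
Qed.

(** Fix [eps] and a finite [F]. Replacing [g] by [w n] on [F] costs at most [d] times the norm of
    the constant [1] on [F], which is finite. The index [n] may depend on [eps] and [F], because the
    bound [a] on [N (w n)] does not depend on [n]. *)
Lemma ga_norm_limit (a : R) (w : nat -> R -> R[i]) g : (0 <= a)%R ->
  (forall n, cmeasurable (Dom X) (w n)) -> cmeasurable (Dom X) g ->
  (forall n, N (w n) <= a%:E) ->
  (forall d : R, (0 < d)%R -> exists n, forall k, inX X k ->
    lnorm p (fun x => g x - w n x)%R k <= d%:E) ->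
  N g <= a%:E.
Proof.
move=> a0 mw mg wa wg; apply/ga_normP => eps e0.
have c0 : (0 < eps `^ theta)%R by rewrite powR_gt0.
set r := (q * (1 + eps))%R; have rr0 : (0 < r)%R by exact: r0.
apply: wnorm_fsets => // F [finF FX].
have := @wnorm_fset_cst_lty _ _ _ _ r 1%R (ltW c0) finF.
set K := wnorm F _ _ (fun=> 1) => Koo.
have K0 : 0 <= K by exact: poweR_ge0.
apply/lee_addgt0Pr => d d0.
(* Adding [1] keeps the denominator positive if [K] is zero and still leaves a total error of at
   most [d]. *)
have d'0 : (0 < d / (fine K + 1))%R.
  by rewrite divr_gt0// ltr_wpDl// fine_ge0.
have [n wn] := wg _ d'0; move: d'0 wn; set d' := (d / _)%R => d'0 wn.
(* The factor [1] is kept so that the error term has the form to which [wnormZ] applies. *)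
apply: (@le_trans _ _ (wnorm F (eps `^ theta) r
    (fun k => lnorm p (w n) k + d'%:E * 1))).
  apply: le_wnorm => //; first exact: ltW.
    by move=> k _; exact: lnorm_ge0.
  move=> k Fk; rewrite mule1; apply: le_trans (leeD (lexx _) (wn _ (FX _ Fk))).
  rewrite [X in lnorm _ X](_ : g = (fun x => w n x + (g x - w n x))%R); last first.
    by apply/funext => x; rewrite addrC subrK.
  apply: lnormD => //; first exact: (cmeasurable_Ik (FX _ Fk)).
  by apply: (cmeasurable_Ik (FX _ Fk)); exact: cmeasurableB.
apply: le_trans (wnormD _ _ _ _ _) _.
- exact: ltW.
- exact: r1.
- by move=> k; exact: lnorm_ge0.
- by move=> k; rewrite mule1 lee_fin ltW.
apply: leeD.
  apply: le_trans (wa n); apply: le_trans (wnorm_le_ga_norm _ e0).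
  by apply: le_wnorm_subset => //; exact: ltW.
rewrite wnormZ ?(ltW c0) ?(ltW d'0)//; rewrite -/K.
have Kfin : K \is a fin_num by rewrite ge0_fin_numE.
rewrite -(fineK Kfin) -EFinM lee_fin /d' mulrAC ler_pdivrMr.
  by rewrite ler_pM2l// lerDl.
by rewrite ltr_wpDl// fine_ge0.
Qed.

End GrandNorm.

(** * The almost everywhere limit and completeness *)

Section Completeness.
Local Open Scope classical_set_scope.
Variable R : realType.
Variables (X : index_set) (p q theta : R).
Hypotheses (p1 : 1 <= p) (q1 : 1 <= q).

Let p0 : 0 < p. Proof. by rewrite (lt_le_trans _ p1). Qed.

Local Notation N := (ga_norm X p q theta).
Local Notation L := (grand_amalgam X p q theta).

Lemma grand_amalgamP (g : R -> R[i]) :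
  L g <-> cmeasurable (Dom X) g /\ (N g < +oo)%E.
Proof.
split=> [[mg [_ Ng]]//|[mg Ng]]; split=> //; split=> // k Xk.
by rewrite -lnorm_lty// (le_lt_trans (lnorm_le_ga_norm p theta q1 _ Xk) Ng).
Qed.

(* Using the upper limit makes measurability automatic; where it is infinite,
   [fine] returns [0]. *)
Definition ae_limit (v : nat -> R -> R[i]) (x : R) : R[i] :=
  (fine (limn_esup (fun n => (complex.Re (v n x))%:E)) +i*
   fine (limn_esup (fun n => (complex.Im (v n x))%:E)))%C.

Lemma cmeasurable_ae_limit D (v : nat -> R -> R[i]) :
  (forall n, cmeasurable D (v n)) -> cmeasurable D (ae_limit v).
Proof.
move=> mv.
have mlim (f : nat -> R -> R) : (forall n, measurable_fun D (f n)) ->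
    measurable_fun D (fun x => fine (limn_esup (fun n => (f n x)%:E))).
  move=> mf; apply: (measurableT_comp (f := fine)).
    exact: fine_measurable.
  apply: (measurable_fun_limn_esup (f := fun n x => (f n x)%:E)) => n.
  exact/measurable_EFinP.
by split; apply: (mlim (fun n x => _)) => n; case: (mv n).
Qed.

(** Where a real sequence converges, its upper limit is its limit and is finite. *)
Lemma ccvg_ae_limit (v : nat -> R -> R[i]) x :
  cvgn (fun n => complex.Re (v n x)) -> cvgn (fun n => complex.Im (v n x)) ->
  ccvg (v ^~ x) (ae_limit v x).
Proof.
have H (u : R^nat) : cvgn u -> u n @[n --> \oo] --> fine (limn_esup (EFin \o u)).
  move=> /cvg_ex[l ul]; have /cvg_limn_einf_sup[_ ->] // :
    (EFin \o u) n @[n --> \oo] --> l%:E.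
  by apply: cvg_EFin => //; exact: nearW.
by move=> cr ci; split; exact: H.
Qed.

Lemma ga_norm_complete (u : nat -> R -> R[i]) : (forall n, L (u n)) ->
  (forall e : R, 0 < e -> exists N0 : nat, forall m n, (N0 <= m)%N -> (N0 <= n)%N ->
    (N (fun x => (u n x - u m x)%R) < e%:E)%E) ->
  exists2 g, L g &
    forall e : R, 0 < e -> exists N0 : nat, forall n, (N0 <= n)%N ->
      (N (fun x => (u n x - g x)%R) < e%:E)%E.
Proof.
move=> Lu cu; have mu n : cmeasurable (Dom X) (u n) by case: (Lu n).
have muk n k : inX X k -> cmeasurable (Ik k) (u n).
  by move=> Xk; exact: (cmeasurable_Ik Xk).
have /choice[phi0 phi0P] : forall j : nat, exists N0 : nat, forall m n,
    (N0 <= m)%N -> (N0 <= n)%N ->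
    (N (fun x => (u n x - u m x)%R) < (2^-1 ^+ j)%:E)%E.
  by move=> j; apply: cu; rewrite exprn_gt0.
(* The summand [j] makes the subsequence cofinal; the maximum puts [phi j] and [phi (j+1)] both
   beyond [phi0 j], so consecutive terms differ by less than [2^-j]. *)
pose phi j := (j + \max_(i < j.+1) phi0 i)%N.
have phi_ge j : (j <= phi j)%N by exact: leq_addr.
have phi0_le i j : (i <= j)%N -> (phi0 i <= phi j)%N.
  move=> ij; apply: leq_trans (leq_addl _ _).
  exact: (@leq_bigmax _ (fun i : 'I_j.+1 => phi0 i) (Ordinal (ij : (i < j.+1)%N))).
pose v j := u (phi j); pose g := ae_limit v.
have mv j : cmeasurable (Dom X) (v j) by exact: mu.
have mg : cmeasurable (Dom X) g by exact: cmeasurable_ae_limit.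
have vg k : inX X k ->
    {ae lebesgue_measure, forall x, Ik k x -> ccvg (v ^~ x) (g x)}.
  move=> Xk.
  have := @ae_cvg_fast R p v k p1 (fun n => muk _ _ Xk).
  move=> H; apply: ae_mono (H _) => [x {}H kx|n].
    by case: (H kx) => cr ci; exact: ccvg_ae_limit.
  apply: le_trans (lnorm_le_ga_norm p theta q1 _ Xk) _; apply: ltW.
  by apply: phi0P; apply: phi0_le.
have local e : 0 < e -> exists N0 : nat, forall n, (N0 <= n)%N ->
    forall k, inX X k -> (lnorm p (fun x => u n x - g x)%R k <= e%:E)%E.
  move=> e0; have [N0 uN] := cu e e0; exists N0 => n Nn k Xk.
  rewrite (@eq_lnorm _ _ _ (fun x => g x - u n x)); last by move=> x; exact: cmodB.
  (* Fatou's lemma is applied with [n] fixed. The shift by [N0] puts every term of the subsequence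
     in the Cauchy range, and [N0] does not depend on [k]. *)
  apply: (@lnorm_fatou _ _ _ (fun j x => v (j + N0)%N x - u n x)) => //.
  - exact: ltW.
  - by move=> j; apply: cmeasurableB; exact: muk.
  - by apply: cmeasurableB; [exact: (cmeasurable_Ik Xk)|exact: muk].
  - apply: ae_mono (vg k Xk) => x H kx.
    apply: (ccvgB (z := fun j => v (j + N0)%N x)).
    by case: (H kx) => Hr Hi; split; [move: Hr|move: Hi];
      rewrite -(cvg_shiftn N0).
  - move=> j; apply: le_trans (lnorm_le_ga_norm p theta q1 _ Xk) _; apply: ltW.
    by apply: uN => //; rewrite (leq_trans _ (phi_ge _))// leq_addl.
have global e : 0 < e -> exists N0 : nat, forall n, (N0 <= n)%N ->
    (N (fun x => u n x - g x)%R <= e%:E)%E.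
  move=> e0; have [N0 uN] := cu e e0; exists N0 => n Nn.
  (* The approximants of [u n - g] are the differences [u n - u (m + N0)]; the error
     [u (m + N0) - g] is locally small uniformly in [k] by [local]. *)
  apply: (@ga_norm_limit _ _ _ _ _ p1 q1 _ (fun m x => u n x - u (m + N0)%N x)).
  - exact: ltW.
  - by move=> m; exact: cmeasurableB.
  - exact: cmeasurableB.
  - by move=> m; apply: ltW; apply: uN => //; rewrite leq_addl.
  move=> d d0; have [N1 uN1] := local d d0; exists N1 => k Xk.
  rewrite (_ : (fun x => _) = (fun x => u (N1 + N0)%N x - g x)).
    by apply: uN1 => //; rewrite leq_addr.
  by apply/funext => x; rewrite opprB addrC addrA subrK.
exists g; last first.
  move=> e e0; have [|N0 H] := global (e / 2); first by rewrite divr_gt0.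
  exists N0 => n /H; move/le_lt_trans; apply.
  by rewrite lte_fin ltr_pdivrMr// ltr_pMr// ltr1n.
apply/grand_amalgamP; split=> //.
have [N0 /(_ _ (leqnn _)) H] := global 1 ltr01.
(* The limit lies in the space, being the sum of one [u N0] and a remainder of norm at most [1]. *)
rewrite (_ : g = (fun x => u N0 x + (g x - u N0 x))); last first.
  by apply/funext => x; rewrite addrC subrK.
apply: le_lt_trans (ga_normD _ p1 q1 _ _) _ => //; first exact: cmeasurableB.
rewrite lte_add_pinfty//; first by case: (Lu N0) => _ [].
by rewrite ga_normB// (le_lt_trans H)// ltry.
Qed.

End Completeness.

(** * Verification of the Banach space axioms *)

Theorem theorem2p4 (R : realType) (X : index_set) (p q theta : R) :
  0 < theta -> 1 <= p -> 1 <= q ->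
  Banach_ae (Dom X) (grand_amalgam X p q theta) (ga_norm X p q theta).
Proof.
move=> _ p1 q1; have LP := @grand_amalgamP R X p q theta p1 q1.
have m0 : @cmeasurable R (Dom X) (fun=> 0) by split; exact: measurable_cst.
have N0 : ga_norm X p q theta (fun=> 0) = 0%E.
  by apply/ga_norm_eq0 => //; exact: aeW.
split; first split.
- by apply/LP; rewrite N0 ltry.
- move=> g h /LP[mg Ng] /LP[mh Nh]; apply/LP; split; first exact: cmeasurableD.
  exact: le_lt_trans (ga_normD theta p1 q1 mg mh) (lte_add_pinfty Ng Nh).
- move=> c g /LP[mg Ng]; apply/LP; split; first exact: cmeasurableZ.
  by rewrite ga_normZ// lte_mul_pinfty ?lee_fin ?cmod_ge0.
split; last exact: ga_norm_complete.
split.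
- by move=> g /LP[mg Ng]; split=> //; exact: ga_norm_ge0.
- by move=> g /LP[mg _]; exact: ga_norm_eq0.
- by move=> c g /LP[mg _]; exact: ga_normZ.
- by move=> g h /LP[mg _] /LP[mh _]; exact: ga_normD.
Qed.
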